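(* If $G$ and $H$ are graphs, then $$M(G[H];x,y)=M(H;x,y)\,D_G\bigl((xy)^{n_H}\bigr)+M\bigl(G;x^{n_H},y^{n_H}\bigr)\,D_H(x)\,D_H(y).$$
   Context: All graphs are finite, simple, and undirected. For a graph $G$, $n_G=|V(G)|$ denotes its order (so $n_H=|V(H)|$), and $\deg_G(g)$ denotes the degree of $g\in V(G)$. For $i\ge 0$ let $n_i(G)=|\{g\in V(G): \deg_G(g)=i\}|$, and for $i\le j$ let $m_{i,j}(G)=|\{\{g,g'\}\in E(G): \{\deg_G(g),\deg_G(g')\}=\{i,j\}\}|$. The degree polynomial of $G$ is $D_G(t)=\sum_i n_i(G)\,t^i$, where $i$ ranges over the vertex degrees of $G$, and the M-polynomial of $G$ is $M(G;x,y)=\sum_{i\le j} m_{i,j}(G)\,x^iy^j$. The lexicographic product $G[H]$ has vertex set $V(G)\times V(H)$; vertices $(g_1,h_1)$ and $(g_2,h_2)$ are adjacent if $g_1g_2\in E(G)$, or $g_1=g_2$ and $h_1h_2\in E(H)$.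
   Formalization: The printed identity fails as a polynomial equality (G=K_2, H=P_3: the right side contains 2x^5y^4, the left does not); it is proved after every monomial x^a y^b on the right side is rewritten as x^min(a,b) y^max(a,b). *)

(* Defs.v *)
From HB Require Import structures.
From mathcomp Require Import all_boot all_order all_algebra.
From mathcomp Require Import mpoly.

Set Implicit Arguments.
Unset Strict Implicit.
Unset Printing Implicit Defensive.

Import GRing.Theory.
Local Open Scope ring_scope.

Record sgraph := SGraph {
  vertex :> finType;
  adj : rel vertex;
  adj_sym : ssrbool.symmetric adj;
  adj_irrefl : irreflexive adj
}.

Definition nverts (G : sgraph) : nat := #|vertex G|.

Definition deg (G : sgraph) (g : G) : nat := #|[set g' : G | adj g g']|.

Definition ndeg (G : sgraph) (i : nat) : nat := #|[set g : G | deg g == i]|.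

(* An edge is the two-element set of its ends, so that each edge counts once;
   [perm_eq] on pairs is equality of the unordered pairs of degrees. *)
Definition medge (G : sgraph) (i j : nat) : nat :=
  #|[set e : {set G} | [exists g : G, exists g' : G,
      [&& adj g g', e == [set g; g'] & perm_eq [:: deg g; deg g'] [:: i; j]]]]|.

(* Every vertex degree is smaller than the order of the graph. *)
Definition degpoly (G : sgraph) : {poly int} :=
  \sum_(0 <= i < nverts G) (ndeg G i)%:R *: 'X^i.

Notation bipoly := {mpoly int[2]}.

Definition varx : bipoly := 'X_(0 : 'I_2).
Definition vary : bipoly := 'X_(1 : 'I_2).

Definition Mpoly (G : sgraph) : bipoly :=
  \sum_(0 <= i < nverts G) \sum_(0 <= j < nverts G | (i <= j)%N)
    (medge G i j)%:R *: (varx ^+ i * vary ^+ j).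

(* M(G; a, b) *)
Definition Msubst (G : sgraph) (a b : bipoly) : bipoly :=
  Mpoly G \mPo [tuple a; b].

(* D_G(a) *)
Definition degsubst (G : sgraph) (a : bipoly) : bipoly :=
  horner_alg a (degpoly G).

Section Lexicographic.
Variables G H : sgraph.

Definition lex_adj : rel (G * H) :=
  fun u v => adj u.1 v.1 || ((u.1 == v.1) && adj u.2 v.2).

Lemma lex_adj_sym : ssrbool.symmetric lex_adj.
Proof.
by move=> u v; rewrite /lex_adj adj_sym [u.1 == _]eq_sym [adj u.2 _]adj_sym.
Qed.

Lemma lex_adj_irrefl : irreflexive lex_adj.
Proof. by move=> u; rewrite /lex_adj !adj_irrefl andbF. Qed.

Definition lexprod : sgraph :=
  @SGraph (G * H)%type lex_adj lex_adj_sym lex_adj_irrefl.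

End Lexicographic.

(* In an M-polynomial the monomial of an edge records the unordered pair of
   degrees of its ends, and is written x^i y^j with i <= j.  A product such as
   D_H(x) D_H(y) also yields monomials x^j y^i with i < j (as soon as H has two
   different degrees); these stand for the same unordered pair {i, j}.
   [unordered p] rewrites every monomial x^i y^j of p as x^(min i j) y^(max i j),
   keeping its coefficient. *)
Definition unordered (p : bipoly) : bipoly :=
  \sum_(m <- msupp p)
    p@_m *: (varx ^+ minn (m (0 : 'I_2)) (m (1 : 'I_2)) *
             vary ^+ maxn (m (0 : 'I_2)) (m (1 : 'I_2))).

(* Main.v *)
(* Twice the M-polynomial is a sum over darts, i.e. ordered pairs of adjacent
   vertices, and polynomials over the integers have no 2-torsion, so it suffices
   to compare sums over darts.  A vertex (g, h) of G[H] has degree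
   n_H deg g + deg h.  The darts of G[H] inside a fibre {g} x H yield the first
   summand; those above a dart (g, g') of G yield the second one, because
   exchanging h and h' in the sum over H x H absorbs the reordering of the two
   exponents when deg g > deg g'. *)
Require Import Defs.
From mathcomp Require Import all_boot all_order all_algebra.
From mathcomp Require Import mpoly ssrcomplements zify.

Import GRing.Theory.
Local Open Scope ring_scope.

(** The monomial of the unordered degree pair {i, j}. Being symmetric in [i] and [j], it can be
    attached to a dart whatever its orientation. *)
Definition umono (i j : nat) : bipoly :=
  varx ^+ minn i j * vary ^+ maxn i j.

Lemma umonoC i j : umono i j = umono j i.
Proof. by rewrite /umono minnC maxnC. Qed.

Lemma umono_shift k i j :
  umono i j * (varx * vary) ^+ k = umono (k + i) (k + j).
Proof.
rewrite /umono -addn_minr -addn_maxr !exprD exprMn.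
by rewrite mulrACA; congr (_ * _); exact: mulrC.
Qed.

(** Monomials outside the support have coefficient 0. An index set independent of [p] lets several
    polynomials be compared term by term, which gives additivity. *)
Lemma unordered_widen k (p : bipoly) : (msize p <= k)%N ->
  unordered p = \sum_(m : 'X_{1..2 < k})
    p@_m *: umono (m (0 : 'I_2)) (m (1 : 'I_2)).
Proof.
move=> le_pk; rewrite /unordered (big_mksub 'X_{1..2 < k}) ?msupp_uniq //=.
  by rewrite big_rmcond //= => m /memN_msupp_eq0 ->; rewrite scale0r.
by move=> m /msize_mdeg_lt /leq_trans; apply.
Qed.

Lemma unorderedD : {morph unordered : p q / p + q}.
Proof.
move=> p q; pose k := maxn (maxn (msize p) (msize q)) (msize (p + q)).
rewrite !(@unordered_widen k) ?leq_max ?leqnn ?orbT // -big_split /=.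
by apply: eq_bigr => m _; rewrite mcoeffD scalerDl.
Qed.

Lemma unordered0 : unordered 0 = 0.
Proof. by rewrite /unordered msupp0 big_nil. Qed.

Lemma unordered_sum (I : Type) (r : seq I) (P : pred I) (F : I -> bipoly) :
  unordered (\sum_(i <- r | P i) F i) = \sum_(i <- r | P i) unordered (F i).
Proof. exact: (big_morph _ unorderedD unordered0). Qed.

Lemma unorderedMn p n : unordered (p *+ n) = unordered p *+ n.
Proof.
elim: n => [|n IHn]; first by rewrite !mulr0n unordered0.
by rewrite !mulrSr unorderedD IHn.
Qed.

Lemma unordered_mono i j : unordered (varx ^+ i * vary ^+ j) = umono i j.
Proof.
rewrite /varx /vary !mpolyXn -mpolyXD /unordered msuppX big_seq1 mcoeffX eqxx.
by rewrite scale1r !mnmDE !mulmnE !mnm1E /= !(mul0n, mul1n, addn0, add0n).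
Qed.

Lemma unordered_umono i j : unordered (umono i j) = umono i j.
Proof.
have le_mM : (minn i j <= maxn i j)%N.
  exact: leq_trans (geq_minl i j) (leq_maxl i j).
by rewrite unordered_mono /umono (minn_idPl le_mM) (maxn_idPr le_mM).
Qed.

Lemma bipoly_double_inj (p q : bipoly) : p *+ 2 = q *+ 2 -> p = q.
Proof.
move=> eq_pq; apply/mpolyP => m; apply/eqP.
by rewrite -(@Num.Theory.eqr_pMn2r int 2) // -!mcoeffMn eq_pq.
Qed.

Lemma deg_ltn (G : sgraph) (g : G) : (deg g < nverts G)%N.
Proof.
rewrite /deg /nverts -cardsT; apply/proper_card/properP; split.
  exact: subsetT.
by exists g; rewrite !inE ?adj_irrefl.
Qed.

Lemma degpolyE (G : sgraph) : degpoly G = \sum_(g : G) 'X^(deg g).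
Proof.
rewrite /degpoly big_mkord.
rewrite [RHS](partition_big (fun g => Ordinal (deg_ltn G g)) predT) //=.
apply: eq_bigr => i _; rewrite (eq_bigr (fun=> 'X^i)) => [|g /eqP <- //].
rewrite sumr_const scaler_nat; congr (_ *+ _).
by rewrite /ndeg cardsE; apply: eq_card => g.
Qed.

Lemma degsubstE (G : sgraph) (a : bipoly) :
  degsubst G a = \sum_(g : G) a ^+ deg g.
Proof.
rewrite /degsubst degpolyE rmorph_sum; apply: eq_bigr => g _ /=.
by rewrite rmorphXn /= horner_algX.
Qed.

Lemma perm_pair_minmax (a b i j : nat) : (i <= j)%N ->
  perm_eq [:: a; b] [:: i; j] = (i == minn a b) && (j == maxn a b).
Proof.
move=> le_ij; apply/idP/idP => [ab_ij|].
  have := perm_mem ab_ij a; have := perm_mem ab_ij b.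
  have := perm_mem ab_ij i; have := perm_mem ab_ij j.
  rewrite !inE !eqxx !orbT /=.
  by move=> /orP[]/eqP ? /orP[]/eqP ? /esym/orP[]/eqP ? /esym/orP[]/eqP ?; lia.
case: leqP => _ /andP[/eqP -> /eqP ->] //.
exact/permPl/(perm_catC [:: a] [:: b]).
Qed.

(** Sending a dart to its set of ends has fibres of size exactly two over edges: both orientations
    occur, and they differ because there are no loops. *)
Lemma card_darts_edge (G : sgraph) (i j : nat) :
  #|[set d : G * G | adj d.1 d.2 & perm_eq [:: deg d.1; deg d.2] [:: i; j]]|
  = (medge G i j).*2.
Proof.
rewrite /medge; set D := [set d | _ & _]; set E := [set e | _].
have DE (d : G * G) : d \in D -> [set d.1; d.2] \in E.
  rewrite !inE => /andP[d_adj d_deg].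
  by apply/existsP; exists d.1; apply/existsP; exists d.2; rewrite d_adj eqxx.
rewrite -sum1_card (partition_big (fun d => [set d.1; d.2]) (mem E)) //=.
rewrite -mul2n mulnC -sum_nat_const; apply: eq_bigr => e.
rewrite inE => /existsP[g /existsP[g' /and3P[gg' /eqP -> deg_gg']]].
have neq_gg' : g != g' by apply: contraTneq gg' => ->; rewrite adj_irrefl.
rewrite sum1dep_card.
have -> : [set d | (d \in D) && ([set d.1; d.2] == [set g; g'])]
        = [set (g, g'); (g', g)].
  apply/setP => -[a b]; rewrite !inE /= !xpair_eqE.
  apply/andP/orP => [[/andP[ab _] /eqP eq_set]|].
    have neq_ab : a != b by apply: contraTneq ab => ->; rewrite adj_irrefl.
    have /set2P : a \in [set g; g'] by rewrite -eq_set set21.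
    have /set2P : b \in [set g; g'] by rewrite -eq_set set22.
    (* Of the four cases, the two outer ones make [a] and [b] the same vertex, against [a != b]. *)
    move=> [] eb [] ea; rewrite ea eb ?eqxx; [ |by right|by left| ];
      by rewrite ea eb eqxx in neq_ab.
  case=> /andP[/eqP -> /eqP ->]; first by rewrite gg' deg_gg' eqxx.
  rewrite adj_sym gg' setUC eqxx; split=> //=.
  by apply: perm_trans deg_gg'; exact/permPl/(perm_catC [:: _] [:: _]).
by rewrite cards2 xpair_eqE (negPf neq_gg').
Qed.

(** Only the index pair (min, max) survives. The double sum has the shape of [Mpoly], so that
    summing over darts and exchanging sums turns the indicators into dart counts. *)
Lemma umono_expand (n a b : nat) : (a < n)%N -> (b < n)%N ->
  umono a b = \sum_(0 <= i < n) \sum_(0 <= j < n | (i <= j)%N)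
    (perm_eq [:: a; b] [:: i; j])%:R *: (varx ^+ i * vary ^+ j).
Proof.
move=> lt_an lt_bn.
have min_lt : (minn a b < n)%N by rewrite gtn_min lt_an.
have max_lt : (maxn a b < n)%N by rewrite gtn_max lt_an.
rewrite big_mkord (bigD1 (Ordinal min_lt)) //= [X in _ + X]big1 ?addr0.
  rewrite big_mkord (bigD1 (Ordinal max_lt)) /=; last by lia.
  rewrite perm_pair_minmax ?eqxx; last by lia.
  rewrite scale1r big1 ?addr0 // => j /andP[le_j]; rewrite -val_eqE /= => neq_j.
  by rewrite perm_pair_minmax // (negPf neq_j) andbF scale0r.
move=> i; rewrite -val_eqE /= => neq_i; apply: big1 => j le_ij.
by rewrite perm_pair_minmax // (negPf neq_i) scale0r.
Qed.

Lemma Mpoly_double (G : sgraph) :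
  Mpoly G *+ 2 = \sum_(d : G * G | adj d.1 d.2) umono (deg d.1) (deg d.2).
Proof.
under [RHS]eq_bigr do rewrite (umono_expand (nverts G)) ?deg_ltn //.
rewrite exchange_big /= /Mpoly -sumrMnl; apply: eq_bigr => i _.
rewrite exchange_big /= -sumrMnl; apply: eq_bigr => j _.
rewrite -scaler_suml scalerMnl; congr (_ *: _).
rewrite -natr_sum -mulrnA muln2 -card_darts_edge; congr _%:R.
rewrite -sum1_card big_mkcond /= [RHS]big_mkcond /=; apply: eq_bigr => d _.
by rewrite inE; case: adj.
Qed.

Lemma Msubst_double (G : sgraph) (a b : bipoly) :
  Msubst G a b *+ 2 = \sum_(d : G * G | adj d.1 d.2)
    a ^+ minn (deg d.1) (deg d.2) * b ^+ maxn (deg d.1) (deg d.2).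
Proof.
rewrite /Msubst -comp_mpolyMn Mpoly_double rmorph_sum; apply: eq_bigr => d _ /=.
by rewrite /umono rmorphM !rmorphXn /= !comp_mpolyXU.
Qed.

(** The neighbourhood is the union of N(g) x V(H) and {g} x N(h), which are disjoint since [g] is
    not adjacent to itself. *)
Lemma deg_lexprod (G H : sgraph) (g : G) (h : H) :
  deg ((g, h) : lexprod G H) = (nverts H * deg g + deg h)%N.
Proof.
rewrite /deg; pose N := [set g' | adj g g']; pose M := [set h' | adj h h'].
have -> : [set v : lexprod G H | adj ((g, h) : lexprod G H) v]
        = setX N setT :|: setX [set g] M.
  by apply/setP => -[g' h']; rewrite !inE /= /lex_adj /= andbT (eq_sym g).
rewrite cardsU !cardsX cards1 cardsT mul1n mulnC.
suff -> : setX N [set: H] :&: setX [set g] M = set0 by rewrite cards0 subn0.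
apply/setP => -[g' h']; rewrite !inE /= andbT.
by case: eqP => [->|_]; rewrite ?adj_irrefl ?andbF.
Qed.

Lemma sum_umono_swap (H : sgraph) (i j : nat) :
  \sum_(h : H) \sum_(h' : H) umono (i + deg h) (j + deg h')
  = \sum_(h : H) \sum_(h' : H) umono (j + deg h) (i + deg h').
Proof.
by rewrite exchange_big; do 2!apply: eq_bigr => ? _; rewrite umonoC.
Qed.

Lemma unordered_cross (H : sgraph) (n a b : nat) :
  unordered ((varx ^+ n) ^+ minn a b * (vary ^+ n) ^+ maxn a b
             * degsubst H varx * degsubst H vary)
  = \sum_(h : H) \sum_(h' : H) umono (n * a + deg h) (n * b + deg h').
Proof.
(* Both sides are symmetric in [a] and [b]: the left one through min and max, the right one by
   [sum_umono_swap]. *)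
wlog le_ab : a b / (a <= b)%N => [IH|].
  case/orP: (leq_total a b) => [|le_ba]; first exact: IH.
  rewrite minnC maxnC sum_umono_swap; exact: IH.
rewrite (minn_idPl le_ab) (maxn_idPr le_ab) !degsubstE -mulrA big_distrlr /=.
rewrite mulr_sumr unordered_sum; apply: eq_bigr => h _.
rewrite mulr_sumr unordered_sum; apply: eq_bigr => h' _.
by rewrite mulrACA -!exprM -!exprD unordered_mono.
Qed.

Lemma big_lex_adj (G H : sgraph) (F : G * H -> G * H -> bipoly) :
  \sum_(d : lexprod G H * lexprod G H | adj d.1 d.2) F d.1 d.2
  = \sum_(g : G) \sum_(d : H * H | adj d.1 d.2) F (g, d.1) (g, d.2)
    + \sum_(d : G * G | adj d.1 d.2)
        \sum_(h : H) \sum_(h' : H) F (d.1, h) (d.2, h').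
Proof.
(* Split the darts by whether their first coordinates are adjacent in [G]. *)
rewrite (bigID (fun d : (G * H) * (G * H) => adj d.1.1 d.2.1)) /= addrC.
congr (_ + _).
  rewrite pair_big_dep /=.
  pose f (p : G * (H * H)) := ((p.1, p.2.1), (p.1, p.2.2)).
  (* If the first coordinates are not adjacent they are equal, so the inverse map may keep only one
     of them. *)
  rewrite (reindex_onto f (fun d => (d.1.1, (d.1.2, d.2.2)))) /=; last first.
    move=> [[g h] [g' h']] /=; rewrite /lex_adj /= => /andP[].
    by case: adj => //= /andP[/eqP -> _].
  apply: eq_bigl => -[g [h h']].
  by rewrite /f /= /lex_adj /= !eqxx adj_irrefl /= !andbT.
under [RHS]eq_bigr do rewrite pair_big /=.
rewrite pair_big_dep /=.
pose f (p : (G * G) * (H * H)) := ((p.1.1, p.2.1), (p.1.2, p.2.2)).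
rewrite (reindex_onto f (fun d => ((d.1.1, d.2.1), (d.1.2, d.2.2)))) /=.
  apply: eq_bigl => -[[g g'] [h h']].
  by rewrite /f /= /lex_adj /= !eqxx !andbT; case: (adj g g'); rewrite ?andbF.
by move=> [[g h] [g' h']].
Qed.

Theorem corollary3p6 (G H : sgraph) :
  Mpoly (lexprod G H) =
  unordered
    (Msubst H varx vary * degsubst G ((varx * vary) ^+ nverts H)
     + Msubst G (varx ^+ nverts H) (vary ^+ nverts H)
       * degsubst H varx * degsubst H vary).
Proof.
apply: bipoly_double_inj; rewrite -unorderedMn mulrnDl unorderedD.
(* In each product the factor 2 is moved onto the [Msubst] factor, the only one that counts
   edges. *)
rewrite -!mulrnAl !Msubst_double Mpoly_double.
rewrite (big_lex_adj G H (fun u v => umono (deg (u : lexprod G H))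
                                           (deg (v : lexprod G H)))).
congr (_ + _).
  rewrite degsubstE mulr_sumr unordered_sum; apply: eq_bigr => g _.
  rewrite mulr_suml unordered_sum; apply: eq_bigr => d _.
  (* Inside a fibre both degrees are shifted by the same amount, which preserves their order. *)
  rewrite !deg_lexprod -exprM -[X in X * _]/(umono (deg d.1) (deg d.2)).
  by rewrite umono_shift unordered_umono.
rewrite -mulrA mulr_suml unordered_sum; apply: eq_bigr => d _.
rewrite mulrA unordered_cross; do 2!apply: eq_bigr => ? _.
by rewrite !deg_lexprod.
Qed.
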